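(* Let $k$ be a commutative ring, $(\mathcal{O},\mu)$ an operad with multiplication in $k$-modules and $\mathcal{M}$ a cyclic unital comp module over $\mathcal{O}$. For any two cocycles $\varphi\in\mathcal{O}(p)$ and $\psi\in\mathcal{O}(q)$ (i.e. $\delta\varphi=0$, $\delta\psi=0$), the induced maps $$\mathcal{L}_\varphi:H_\bullet(\mathcal{M})\to H_{\bullet-p+1}(\mathcal{M}),\qquad \iota_\psi:H_\bullet(\mathcal{M})\to H_{\bullet-q}(\mathcal{M})$$ on the homology of $(\mathcal{M}_\bullet,b)$ satisfy $$[\iota_\psi,\mathcal{L}_\varphi]=\iota_{\{\psi,\varphi\}},$$ where $[\iota_\psi,\mathcal{L}_\varphi]=\iota_\psi\mathcal{L}_\varphi-(-1)^{q(p-1)}\mathcal{L}_\varphi\iota_\psi$ is the graded commutator.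
   Context: Unadorned tensor products are over $k$. Operad with multiplication. An operad (non-$\Sigma$, in $k$-modules) is a sequence $\{\mathcal{O}(n)\}_{n\ge0}$ of $k$-modules with $k$-bilinear operations $\circ_i:\mathcal{O}(p)\otimes\mathcal{O}(q)\to\mathcal{O}(p+q-1)$ and an identity $\mathbb{1}\in\mathcal{O}(1)$ such that for $\varphi\in\mathcal{O}(p)$, $\psi\in\mathcal{O}(q)$, $\chi\in\mathcal{O}(r)$: $\varphi\circ_i\psi=0$ if $p<i$ or $p=0$; $$(\varphi\circ_i\psi)\circ_j\chi=\begin{cases}(\varphi\circ_j\chi)\circ_{i+r-1}\psi & j<i,\\ \varphi\circ_i(\psi\circ_{j-i+1}\chi) & i\le j<q+i,\\ (\varphi\circ_{j-q+1}\chi)\circ_i\psi & j\ge q+i;\end{cases}$$ and $\varphi\circ_i\mathbb{1}=\mathbb{1}\circ_1\varphi=\varphi$ for $i\le p$. It is an operad with multiplication if there are $\mu\in\mathcal{O}(2)$ and $e\in\mathcal{O}(0)$ (the unit) with $\mu\circ_1\mu=\mu\circ_2\mu$ and $\mu\circ_1e=\mu\circ_2e=\mathbb{1}$. Cyclic unital comp module over $\mathcal{O}$. This is a sequence $\{\mathcal{M}(n)\}_{n\ge0}$ of $k$-modules with $k$-linear maps $\bullet_i:\mathcal{O}(p)\otimes\mathcal{M}(n)\to\mathcal{M}(n-p+1)$, defined for $1\le i\le n-p+1$ when $0\le p\le n$ (declared zero if $p>n$), and for $i=0$ when $0\le p\le n+1$ (declared zero if $p>n+1$), together with $k$-linear maps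 $t:\mathcal{M}(n)\to\mathcal{M}(n)$ (with $t=\mathrm{id}$ on $\mathcal{M}(0)$), such that for $\varphi\in\mathcal{O}(p)$, $\psi\in\mathcal{O}(q)$, $x\in\mathcal{M}(n)$ and all indices $i,j\geq 0$ for which the operations are defined: if $p>0$, $$\varphi\bullet_i(\psi\bullet_jx)=\begin{cases}\psi\bullet_j(\varphi\bullet_{i+q-1}x)& j<i,\\ (\varphi\circ_{j-i+1}\psi)\bullet_ix& j-p<i\le j,\\ \psi\bullet_{j-p+1}(\varphi\bullet_ix)& 0\le i\le j-p;\end{cases}$$ if $p=0$, $$\varphi\bullet_i(\psi\bullet_jx)=\begin{cases}\psi\bullet_j(\varphi\bullet_{i+q-1}x)& j<i,\\ \psi\bullet_{j+1}(\varphi\bullet_ix)& 0\le i\le j;\end{cases}$$ $\mathbb{1}\bullet_ix=x$ for $i=0,\dots,n$; $\ t(\varphi\bullet_ix)=\varphi\bullet_{i+1}t(x)$ for $i=0,\dots,n-p$; and $t^{n+1}=\mathrm{id}$ on $\mathcal{M}(n)$. Structure on $\mathcal{O}^\bullet$, $\mathcal{O}^n:=\mathcal{O}(n)$. For $\varphi\in\mathcal{O}(p)$, $\psi\in\mathcal{O}(q)$ put $\varphi\,\bar\circ\,\psi:=\sum_{i=1}^p(-1)^{(q-1)(i-1)}\varphi\circ_i\psi$, the Gerstenhaber bracket $\{\varphi,\psi\}:=\varphi\,\bar\circ\,\psi-(-1)^{(p-1)(q-1)}\psi\,\bar\circ\,\varphi\in\mathcal{O}(p+q-1)$, and the coboundary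 $\delta\varphi:=\{\mu,\varphi\}\in\mathcal{O}(p+1)$. Structure on $\mathcal{M}_\bullet$, $\mathcal{M}_n:=\mathcal{M}(n)$. The boundary $b:\mathcal{M}_n\to\mathcal{M}_{n-1}$ is $b(x)=\sum_{i=0}^{n-1}(-1)^i\mu\bullet_ix+(-1)^n\mu\bullet_0t(x)$ (and $b=0$ on $\mathcal{M}_0$), and $H_\bullet(\mathcal{M})$ is the homology of $(\mathcal{M}_\bullet,b)$. The cap product is $\iota_\varphi x:=(\mu\circ_2\varphi)\bullet_0x\in\mathcal{M}(n-p)$ for $\varphi\in\mathcal{O}(p)$, $x\in\mathcal{M}(n)$. The Lie derivative $\mathcal{L}_\varphi:\mathcal{M}(n)\to\mathcal{M}(n-p+1)$ along $\varphi\in\mathcal{O}(p)$ is, for $p<n+1$, $$\mathcal{L}_\varphi x:=\sum_{i=1}^{n-p+1}(-1)^{(p-1)(i-1)}\varphi\bullet_ix+\sum_{i=1}^p(-1)^{n(i-1)+p-1}\varphi\bullet_0t^{i-1}(x);$$ for $p=n+1$ it is $\mathcal{L}_\varphi x:=(-1)^{p-1}\varphi\bullet_0N(x)$ with $N=\sum_{i=0}^n(-1)^{in}t^i$; and $\mathcal{L}_\varphi:=0$ for $p>n+1$. One has $b\iota_\varphi-(-1)^p\iota_\varphi b=\iota_{\delta\varphi}$ and $b\mathcal{L}_\varphi-(-1)^{p-1}\mathcal{L}_\varphi b=-\mathcal{L}_{\delta\varphi}$, so that $\iota_\varphi,\mathcal{L}_\varphi$ descend to $H_\bullet(\mathcal{M})$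 when $\varphi$ is a cocycle. *)

(* Defs.v *)
From HB Require Import structures.
From mathcomp Require Import all_boot all_order all_algebra.
From mathcomp Require Import generic_quotient.
From mathcomp Require Import boolp.

Set Implicit Arguments.
Unset Strict Implicit.
Unset Printing Implicit Defensive.

Import GRing.Theory.
Local Open Scope ring_scope.
Local Open Scope quotient_scope.

(* Degrees.  An operation landing in degree p + q - 1 or n - p + 1 takes its
   target degree as an argument, which is meaningful only if the degree
   equation (r + 1 = p + q, resp. m + p = n + 1) holds; for all other targets
   the operation is 0.  Hence no casts between O (p + q - 1) and provably equal
   degrees are needed, and a map into a negative degree is always 0. *)

(* Non-Sigma operads in k-modules.  [circ r i f g] is f o_i g, with i >= 1. *)
Record operad (k : comPzRingType) := Operad {
  op_sort :> nat -> lmodType k;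
  circ : forall p q r : nat, nat -> op_sort p -> op_sort q -> op_sort r;
  op_id : op_sort 1;
  circ_deg : forall p q r i (f : op_sort p) (g : op_sort q),
    r.+1 <> (p + q)%N -> circ r i f g = 0;
  circ_linearl : forall p q r i (g : op_sort q),
    linear (fun f : op_sort p => circ r i f g);
  circ_linearr : forall p q r i (f : op_sort p),
    linear (fun g : op_sort q => circ r i f g);
  circ_out : forall p q r i (f : op_sort p) (g : op_sort q),
    (p < i)%N || (p == 0)%N -> circ r i f g = 0;
  (* a, b are the degrees of the intermediate composites, s of the result *)
  circ_assoc_lt : forall p q r a b s i j
      (f : op_sort p) (g : op_sort q) (h : op_sort r),
    a.+1 = (p + q)%N -> b.+1 = (p + r)%N -> s.+1 = (a + r)%N ->
    (0 < j)%N -> (j < i)%N ->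
    circ s j (circ a i f g) h = circ s (i + r).-1 (circ b j f h) g;
  circ_assoc_mid : forall p q r a b s i j
      (f : op_sort p) (g : op_sort q) (h : op_sort r),
    a.+1 = (p + q)%N -> b.+1 = (q + r)%N -> s.+1 = (a + r)%N ->
    (0 < i)%N -> (i <= j)%N -> (j < q + i)%N ->
    circ s j (circ a i f g) h = circ s i f (circ b (j - i).+1 g h);
  circ_assoc_ge : forall p q r a b s i j
      (f : op_sort p) (g : op_sort q) (h : op_sort r),
    a.+1 = (p + q)%N -> b.+1 = (p + r)%N -> s.+1 = (a + r)%N ->
    (0 < i)%N -> (q + i <= j)%N ->
    circ s j (circ a i f g) h = circ s i (circ b (j - q).+1 f h) g;
  circ_idr : forall p i (f : op_sort p),
    (0 < i)%N -> (i <= p)%N -> circ p i f op_id = f;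
  circ_idl : forall p (f : op_sort p), circ p 1 op_id f = f
}.

Arguments circ {k o p q r}.
Arguments op_id {k o}.

(* (mu, e) makes O an operad with multiplication. *)
Definition multiplication (k : comPzRingType) (O : operad k)
    (mu : O 2%N) (e : O 0%N) : Prop :=
  [/\ circ 1 mu mu = circ 2 mu mu :> O 3%N,
      circ 1 mu e = op_id :> O 1%N & circ 2 mu e = op_id :> O 1%N].

(* Cyclic unital comp modules.  [act m i f x] is f *_i x in M(m); for
   m + p = n + 1 it is defined for 0 <= i <= m.  In the three relations below,
   l = n - q + 1 and l' = n - p + 1.  They are stated for all p at once: for
   p = 0 the range of [act_mid] is empty and the other two relations are those
   of the case p = 0. *)
Record cyclic_module (k : comPzRingType) (O : operad k) := CyclicModule {
  cm_sort :> nat -> lmodType k;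
  act : forall p n m : nat, nat -> O p -> cm_sort n -> cm_sort m;
  cyc : forall n : nat, cm_sort n -> cm_sort n;
  act_deg : forall p n m i (f : O p) (x : cm_sort n),
    (m + p)%N <> n.+1 -> act m i f x = 0;
  act_out : forall p n m i (f : O p) (x : cm_sort n),
    (0 < i)%N -> (n < p)%N -> act m i f x = 0;
  act_linearl : forall p n m i (x : cm_sort n),
    linear (fun f : O p => act m i f x);
  act_linearr : forall p n m i (f : O p),
    linear (fun x : cm_sort n => act m i f x);
  cyc_linear : forall n, linear (@cyc n);
  act_lt : forall p q n l l' m i j (f : O p) (g : O q) (x : cm_sort n),
    (l + q)%N = n.+1 -> (l' + p)%N = n.+1 -> (m + p)%N = l.+1 ->
    (j < i)%N -> (j <= l)%N -> (i <= m)%N ->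
    act m i f (act l j g x) = act m j g (act l' (i + q).-1 f x);
  act_mid : forall p q n l r m i j (f : O p) (g : O q) (x : cm_sort n),
    (l + q)%N = n.+1 -> r.+1 = (p + q)%N -> (m + p)%N = l.+1 ->
    (i <= j)%N -> (j < i + p)%N -> (j <= l)%N -> (i <= m)%N ->
    act m i f (act l j g x) = act m i (circ (j - i).+1 f g : O r) x;
  act_ge : forall p q n l l' m i j (f : O p) (g : O q) (x : cm_sort n),
    (l + q)%N = n.+1 -> (l' + p)%N = n.+1 -> (m + p)%N = l.+1 ->
    (i + p <= j)%N -> (j <= l)%N -> (i <= m)%N ->
    act m i f (act l j g x) = act m (j - p).+1 g (act l' i f x);
  act_id : forall n i (x : cm_sort n), (i <= n)%N -> act n i op_id x = x;
  cyc_act : forall p n m i (f : O p) (x : cm_sort n),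
    (m + p)%N = n.+1 -> (i < m)%N ->
    cyc (act m i f x) = act m i.+1 f (cyc x);
  cyc0 : forall x : cm_sort 0%N, cyc x = x;
  cyc_order : forall n (x : cm_sort n), iter n.+1 (@cyc n) x = x
}.

Arguments act {k O c p n m}.
Arguments cyc {k O c n}.

Section Homology.

(* The homology at V of  U --d1--> V --d0--> W.  When d0 \o d1 = 0 this is
   ker d0 / im d1; in general the quotient is by im d1 :&: ker d0. *)
Variables (k : comPzRingType) (U V W : lmodType k).
Variables (d1 : {linear U -> V}) (d0 : {linear V -> W}).

Definition is_cycle : {pred V} := [pred x | d0 x == 0].

Fact is_cycle_submod : submod_closed is_cycle.
Proof.
split=> [|a x y]; rewrite !inE ?linear0 // => /eqP x0 /eqP y0.
by rewrite linearP x0 y0 scaler0 addr0.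
Qed.

HB.instance Definition _ :=
  GRing.isSubmodClosed.Build k V is_cycle (is_cycle_submod).

Record cycle := Cycle { cycle_val : V; _ : cycle_val \in is_cycle }.

HB.instance Definition _ := [isSub for cycle_val].
HB.instance Definition _ := [Choice of cycle by <:].
HB.instance Definition _ := [SubChoice_isSubLmodule of cycle by <:].

Definition homologous (x y : cycle) : bool :=
  `[< exists u : U, d1 u = val x - val y >].

Fact homologous_refl : reflexive homologous.
Proof. by move=> x; apply/asboolP; exists 0; rewrite linear0 subrr. Qed.

Fact homologous_sym : symmetric homologous.
Proof.
suff H x y : homologous x y -> homologous y x by move=> x y; apply/idP/idP => /H.
by move=> /asboolP[u du]; apply/asboolP; exists (- u); rewrite linearN du opprB.
Qed.

Fact homologous_trans : transitive homologous.
Proof.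
move=> y x z /asboolP[u du] /asboolP[v dv]; apply/asboolP; exists (u + v).
by rewrite linearD du dv addrA subrK.
Qed.

Canonical homologous_equiv :=
  EquivRel homologous homologous_refl homologous_sym homologous_trans.

Definition homology := {eq_quot homologous}.

HB.instance Definition _ := Choice.on homology.
HB.instance Definition _ := EqQuotient.on homology.

Definition homology_class (x : cycle) : homology := \pi x.

Lemma homology_classP (x y : cycle) :
  reflect (exists u : U, d1 u = val x - val y)
          (homology_class x == homology_class y).
Proof. by rewrite eqmodE /=; exact: asboolP. Qed.

Definition homology_add (c d : homology) : homology :=
  homology_class (repr c + repr d).
Definition homology_opp (c : homology) : homology :=
  homology_class (- repr c).
Definition homology_scale (a : k) (c : homology) : homology :=
  homology_class (a *: repr c).

Lemma homology_repr (x : cycle) :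
  exists u : U, d1 u = val (repr (homology_class x)) - val x.
Proof. by apply/homology_classP; rewrite /homology_class reprK. Qed.

Lemma homology_classD (x y : cycle) :
  homology_add (homology_class x) (homology_class y) = homology_class (x + y).
Proof.
have [u du] := homology_repr x; have [v dv] := homology_repr y.
apply/eqP/homology_classP; exists (u + v).
by rewrite linearD du dv !raddfD /= addrACA -opprD.
Qed.

Lemma homology_classN (x : cycle) :
  homology_opp (homology_class x) = homology_class (- x).
Proof.
have [u du] := homology_repr x; apply/eqP/homology_classP; exists (- u).
by rewrite linearN du !raddfN /= opprB opprK addrC.
Qed.

Lemma homology_classZ (a : k) (x : cycle) :
  homology_scale a (homology_class x) = homology_class (a *: x).
Proof.
have [u du] := homology_repr x; apply/eqP/homology_classP; exists (a *: u).
by rewrite linearZ du [LHS]scalerBr.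
Qed.

Lemma homology_ind (P : homology -> Prop) :
  (forall x, P (homology_class x)) -> forall c, P c.
Proof. by move=> H; elim/quotP=> x _; exact: H. Qed.

Fact homology_addA : associative homology_add.
Proof.
elim/homology_ind=> x; elim/homology_ind=> y; elim/homology_ind=> z.
by rewrite !homology_classD addrA.
Qed.

Fact homology_addC : commutative homology_add.
Proof.
by elim/homology_ind=> x; elim/homology_ind=> y; rewrite !homology_classD addrC.
Qed.

Fact homology_add0 : left_id (homology_class 0) homology_add.
Proof. by elim/homology_ind=> x; rewrite homology_classD add0r. Qed.

Fact homology_addN : left_inverse (homology_class 0) homology_opp homology_add.
Proof.
by elim/homology_ind=> x; rewrite homology_classN homology_classD addNr.
Qed.

HB.instance Definition _ := GRing.isZmodule.Build homology
  homology_addA homology_addC homology_add0 homology_addN.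

Fact homology_scaleA (a b : k) (c : homology) :
  homology_scale a (homology_scale b c) = homology_scale (a * b) c.
Proof. by elim/homology_ind: c => x; rewrite !homology_classZ scalerA. Qed.

Fact homology_scale1 : left_id 1 homology_scale.
Proof. by elim/homology_ind=> x; rewrite homology_classZ scale1r. Qed.

Fact homology_scaleDr : right_distributive homology_scale +%R.
Proof.
move=> a; elim/homology_ind=> x; elim/homology_ind=> y.
rewrite [homology_class x + _]homology_classD !homology_classZ.
by rewrite [RHS]homology_classD scalerDr.
Qed.

Fact homology_scaleDl (c : homology) : {morph homology_scale^~ c : a b / a + b}.
Proof.
elim/homology_ind: c => x a b; rewrite !homology_classZ.
by rewrite [RHS]homology_classD scalerDl.
Qed.

HB.instance Definition _ := GRing.Zmodule_isLmodule.Build k homology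
  homology_scaleA homology_scale1 homology_scaleDr homology_scaleDl.

End Homology.

(* The map induced on homology by f, computed on a representative; a
   representative whose image is not a cycle is sent to 0.  By
   [homology_mapE] it is the usual map [x] |-> [f x] whenever f is additive
   and maps cycles to cycles and boundaries to boundaries. *)
Definition homology_map (k : comPzRingType) (U V W U' V' W' : lmodType k)
    (d1 : {linear U -> V}) (d0 : {linear V -> W})
    (d1' : {linear U' -> V'}) (d0' : {linear V' -> W'})
    (f : V -> V') (c : homology d1 d0) : homology d1' d0' :=
  homology_class d1' (insubd (0 : cycle d0') (f (val (repr c)))).

Lemma homology_mapE (k : comPzRingType) (U V W U' V' W' : lmodType k)
    (d1 : {linear U -> V}) (d0 : {linear V -> W})
    (d1' : {linear U' -> V'}) (d0' : {linear V' -> W'}) (f : V -> V')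
    (x : cycle d0) (y : cycle d0') :
  zmod_morphism f ->
  (forall v, d0 v = 0 -> d0' (f v) = 0) ->
  (forall u, exists u', f (d1 u) = d1' u') ->
  f (val x) = val y ->
  homology_map d1' d0' f (homology_class d1 x) = homology_class d1' y.
Proof.
move=> fB fZ fU fxy; have [u du] := homology_repr d1 x.
have [u' du'] := fU u; apply/eqP/homology_classP; exists u'.
rewrite insubdK -?du' ?du ?fB ?fxy // inE.
by apply/eqP/fZ; move: (valP (repr (homology_class d1 x))); rewrite inE => /eqP.
Qed.

Section Calculus.

Variables (k : comPzRingType) (O : operad k) (mu : O 2%N).

(* Signs: (-1)^(p - 1) is written (-1) ^+ p.+1, which is also correct for
   p = 0. *)

(* r = p + q - 1 *)
Definition circ_bar p q r (f : O p) (g : O q) : O r :=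
  \sum_(1 <= i < p.+1) (-1) ^+ (q.+1 * (i - 1)) *: circ i f g.

(* For p = q = 0 the bracket lives in degree -1; here it is 0. *)
Definition bracket p q (f : O p) (g : O q) : O (p + q).-1 :=
  circ_bar _ f g - (-1) ^+ (p.+1 * q.+1) *: circ_bar _ g f.

Definition cobdry p (f : O p) : O p.+1 := bracket mu f.

Variable M : cyclic_module O.

(* On M(0) this is 0 by [act_deg]. *)
Definition bdry n (x : M n) : M n.-1 :=
  \sum_(0 <= i < n) (-1) ^+ i *: act i mu x + (-1) ^+ n *: act 0 mu (cyc x).

Fact bdry_linear n : linear (@bdry n).
Proof.
move=> a x y; rewrite /bdry cyc_linear act_linearr !scalerDr scalerA mulrC.
rewrite -scalerA addrACA; congr (_ + _); rewrite scaler_sumr -big_split.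
apply: eq_bigr => i _ /=.
by rewrite act_linearr scalerDr !scalerA [a * _]mulrC.
Qed.

HB.instance Definition _ n :=
  GRing.isLinear.Build k (M n) (M n.-1) _ (@bdry n) (@bdry_linear n).

(* H_n(M) *)
Definition comp_homology (n : nat) : lmodType k :=
  homology (@bdry n.+1 : {linear M n.+1 -> M n}) (@bdry n).

(* m = n - p *)
Definition cap p n m (f : O p) (x : M n) : M m :=
  act 0 (circ 2 mu f : O p.+1) x.

(* m = n - p + 1 *)
Definition lie p n m (f : O p) (x : M n) : M m :=
  if (p < n.+1)%N then
    \sum_(1 <= i < (n.+1 - p).+1) (-1) ^+ (p.+1 * (i - 1)) *: act i f x
    + \sum_(1 <= i < p.+1)
        (-1) ^+ (n * (i - 1) + p.+1) *: act 0 f (iter (i - 1) cyc x)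
  else if p == n.+1 then
    (-1) ^+ p.+1 *: act 0 f (\sum_(0 <= i < n.+1) (-1) ^+ (i * n) *: iter i cyc x)
  else 0.

Definition cap_homology p n m (f : O p) :
    comp_homology n -> comp_homology m :=
  homology_map _ _ (@cap p n m f).

Definition lie_homology p n m (f : O p) :
    comp_homology n -> comp_homology m :=
  homology_map _ _ (@lie p n m f).

End Calculus.

Arguments cap_homology {k O} mu {M p n m} f.
Arguments lie_homology {k O} mu {M p n m} f.

(* Main.v *)
Require Import Defs.
From HB Require Import structures.
From mathcomp Require Import all_boot all_order all_algebra.
From mathcomp Require Import zify.

Set Implicit Arguments.
Unset Strict Implicit.
Unset Printing Implicit Defensive.

Import GRing.Theory.
Local Open Scope ring_scope.

(** After the sign changes [tau = (-1)^n t], [f *_i = (-1)^((p-1)i) f *_i] and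
    similarly for [o_i], only Koszul signs remain, and
    [L_f = (-1)^(p-1) (A_f + B_f)], where [A_f] inserts [f] away from position 0
    and [B_f = sum_j f *_0 tau^j] inserts it around position 0; moreover
    [b = A_mu + B_mu].  Let [R(f, g)] be the part of [B_(f o g)] in which
    position 0 and then, to its right, [g] occupy different slots of [f]; so
    [R(mu, g)] is the cap product with [g].  Expanding [R(f o mu, g)] and
    [R(mu o f, g)] according to the relative position of [mu] gives
    - [R(f o mu, g) = +- [R(f, g), A_mu] +- R(f, g) B_mu +- R(f, g o mu)
       + R(f, mu o g) + B_f iota_g],
    - [R(mu o f, g) = B_mu R(f, g) +- iota_g B_f + iota_(f o g)],
    while [iota_g A_f = iota_(g o f) +- A_f iota_g].  For cocycles these
    add up to [[iota_g, L_f] - iota_{g, f} = +- [b, R(f, g)]]. *)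

(** * Linear maps, triangular double sums and sign bookkeeping *)

Section LinearFun.
Variables (k : comPzRingType) (U V : lmodType k) (F : U -> V).
Hypothesis Fl : linear F.

Lemma linear_fun_sum I (r : seq I) (P : pred I) E :
  F (\sum_(i <- r | P i) E i) = \sum_(i <- r | P i) F (E i).
Proof.
pose G : {linear U -> V} := HB.pack F (GRing.isLinear.Build k U V _ F Fl).
exact: (raddf_sum G).
Qed.

Lemma linear_funZ a u : F (a *: u) = a *: F u.
Proof.
pose G : {linear U -> V} := HB.pack F (GRing.isLinear.Build k U V _ F Fl).
exact: (linearZ_LR G).
Qed.

Lemma linear_funD u v : F (u + v) = F u + F v.
Proof. by have := Fl 1 u v; rewrite !scale1r. Qed.

Lemma linear_fun0 : F 0 = 0.
Proof. by have := linear_funZ 0 0; rewrite !scale0r. Qed.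

End LinearFun.

Lemma sum_nat_sum_lt (V : nmodType) a n (F : nat -> nat -> V) :
  \sum_(a <= i < n) \sum_(i.+1 <= j < n) F i j =
  \sum_(a <= j < n) \sum_(a <= i < j) F i j.
Proof.
rewrite [LHS]big_nat.
transitivity (\sum_(a <= i < n | (a <= i < n)%N)
    \sum_(a <= j < n | (i < j)%N) F i j).
  apply: eq_bigr => i /andP[ai _].
  by rewrite (big_nat_widenl i.+1 a) //; apply: leqW.
rewrite -big_nat (exchange_big_dep_nat xpredT) //=.
rewrite !big_nat; apply: eq_bigr => j /andP[_ jn].
by rewrite (big_nat_widen a j n) //; apply: ltnW.
Qed.

Lemma signZ_odd (k : pzRingType) (V : lmodType k) a b (v : V) :
  odd a = odd b -> (-1) ^+ a *: v = (-1) ^+ b *: v.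
Proof. by move=> ab; rewrite -signr_odd ab signr_odd. Qed.

Lemma signZZ (k : pzRingType) (V : lmodType k) a b (v : V) :
  (-1) ^+ a *: ((-1) ^+ b *: v) = (-1) ^+ (a + b) *: v.
Proof. by rewrite scalerA exprD. Qed.

Ltac parity := rewrite /= ?(oddD, oddM, oddS) /=; 
  repeat match goal with |- context [odd ?a] => case: (odd a) end.

(* Decides [u = v] in an abelian group, up to the group axioms. *)
Ltac zmodule :=
  apply/eqP; rewrite -subr_eq0; apply/eqP;
  rewrite ?(opprD, opprK, oppr0, addr0, add0r); rewrite -[LHS]addr0 -?addrA;
  repeat lazymatch goal with
  | |- - ?a + _ = 0 =>
    repeat lazymatch goal with
    | |- - a + (a + _) = 0 => fail
    | |- context [?x + (a + ?z)] => rewrite (addrCA x a z)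
    | |- _ => rewrite (addrCA _ a _)
    end;
    first [rewrite addKr | rewrite addNKr]
  | |- ?a + _ = 0 =>
    repeat lazymatch goal with
    | |- a + (- a + _) = 0 => fail
    | |- context [?x + (- a + ?z)] => rewrite (addrCA x (- a) z)
    | |- _ => rewrite (addrCA _ (- a) _)
    end;
    first [rewrite addNKr | rewrite addKr]
  end; try exact: erefl.

(* Decides [u = v] between sums of vectors with coefficients [(-1) ^+ e], by
   cases on the parities of the variables in the exponents. *)
Ltac sign_module :=
  rewrite ?(scalerDr, scalerN, signZZ);
  repeat match goal with
  | |- context [(-1) ^+ ?e *: _] =>
    lazymatch e with nat_of_bool _ => fail | _ => rewrite -(signr_odd _ e) end
  end;
  rewrite ?(oddD, oddM, oddS) /=;
  repeat match goal with |- context [odd ?a] => case: (odd a) => /= end;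
  rewrite ?expr0 ?expr1 ?scaleN1r ?scale1r; zmodule.

(** * Signed partial compositions in the operad *)

(* Slots are counted from 0 here, against from 1 in [circ]. *)
Section SignedOperad.
Variables (k : comPzRingType) (O : operad k).

(** The sign is that of the Gerstenhaber product, so that [circ_bar] becomes a plain sum; [q.+1]
    stands for q - 1, which has the same parity. *)
Definition tcirc p q r i (f : O p) (g : O q) : O r :=
  (-1) ^+ (q.+1 * i) *: circ i.+1 f g.

Lemma tcirc_linearl p q r i (g : O q) : linear (fun f : O p => tcirc r i f g).
Proof.
by move=> a u v; rewrite /tcirc circ_linearl scalerDr !scalerA [_ * a]mulrC.
Qed.

Lemma tcirc_linearr p q r i (f : O p) : linear (fun g : O q => tcirc r i f g).
Proof.
by move=> a u v; rewrite /tcirc circ_linearr scalerDr !scalerA [_ * a]mulrC.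
Qed.

Lemma circ_barE p q r (f : O p) (g : O q) :
  circ_bar r f g = \sum_(0 <= i < p) tcirc r i f g.
Proof. by rewrite /circ_bar big_add1; apply: eq_bigr => i _; rewrite subn1. Qed.

(** Here g and h occupy different slots of f, so exchanging them costs the Koszul sign for the
    degrees q - 1 and r - 1. Nested compositions, in [tcirc_mid], cost none. *)
Lemma tcirc_lt p q r a b s i j (f : O p) (g : O q) (h : O r) :
  a.+1 = (p + q)%N -> b.+1 = (p + r)%N -> s.+1 = (a + r)%N -> (j < i)%N ->
  tcirc s j (tcirc a i f g) h
  = (-1) ^+ (q.+1 * r.+1) *: tcirc s (i + r).-1 (tcirc b j f h) g.
Proof.
move=> da db ds ji; rewrite /tcirc.
rewrite (linear_funZ (@circ_linearl _ _ _ _ _ _ _)).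
rewrite (linear_funZ (@circ_linearl _ _ _ _ _ _ _)) !signZZ.
rewrite (circ_assoc_lt (b := b)) // addSn prednK; last by lia.
by apply: signZ_odd; case: i ji => // i _; rewrite addSn; parity.
Qed.

Lemma tcirc_mid p q r a b s i j (f : O p) (g : O q) (h : O r) :
  a.+1 = (p + q)%N -> b.+1 = (q + r)%N -> s.+1 = (a + r)%N ->
  (i <= j)%N -> (j < q + i)%N ->
  tcirc s j (tcirc a i f g) h = tcirc s i f (tcirc b (j - i) g h).
Proof.
move=> da db ds ij jq; rewrite /tcirc.
rewrite (linear_funZ (@circ_linearl _ _ _ _ _ _ _)).
rewrite (linear_funZ (@circ_linearr _ _ _ _ _ _ _)) !signZZ.
rewrite (circ_assoc_mid (b := b)) //; last by lia.
rewrite subSS; apply: signZ_odd; have -> : j = (i + (j - i))%N by lia.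
by rewrite addKn db; parity.
Qed.

Lemma tcirc_ge p q r a b s i j (f : O p) (g : O q) (h : O r) :
  a.+1 = (p + q)%N -> b.+1 = (p + r)%N -> s.+1 = (a + r)%N -> (q + i <= j)%N ->
  tcirc s j (tcirc a i f g) h
  = (-1) ^+ (q.+1 * r.+1) *: tcirc s i (tcirc b (j.+1 - q) f h) g.
Proof.
move=> da db ds ij; rewrite /tcirc.
rewrite (linear_funZ (@circ_linearl _ _ _ _ _ _ _)).
rewrite (linear_funZ (@circ_linearl _ _ _ _ _ _ _)) !signZZ.
rewrite (circ_assoc_ge (b := b)) //; last by lia.
apply: signZ_odd; have -> : j = (q + (j - q))%N by lia.
have -> : ((q + (j - q)).+1 - q)%N = (j - q).+1 by lia.
by parity.
Qed.

End SignedOperad.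

(** * Signed actions and the signed cyclic operator *)

Section SignedModule.
Variables (k : comPzRingType) (O : operad k) (M : cyclic_module O).

Definition sact p n m i (f : O p) (x : M n) : M m :=
  (-1) ^+ (p.+1 * i) *: act i f x.

(** This sign preserves the order n + 1, because n (n + 1) is even, and lets [tau] pass an insertion
    without a sign, see [tau_sact]. *)
Definition tau n (x : M n) : M n := (-1) ^+ n *: cyc x.

Lemma sact_linearl p n m i (x : M n) : linear (fun f : O p => sact m i f x).
Proof.
by move=> a u v; rewrite /sact act_linearl scalerDr !scalerA [_ * a]mulrC.
Qed.

Lemma sact_linearr p n m i (f : O p) : linear (fun x : M n => sact m i f x).
Proof.
by move=> a u v; rewrite /sact act_linearr scalerDr !scalerA [_ * a]mulrC.
Qed.

Lemma tau_linear n : linear (@tau n).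
Proof.
by move=> a u v; rewrite /tau cyc_linear scalerDr !scalerA [_ * a]mulrC.
Qed.

Lemma iter_tau_linear n j : linear (iter j (@tau n)).
Proof. by elim: j => [|j IH] a u v //=; rewrite IH tau_linear. Qed.

Lemma iter_tauE n j (x : M n) : iter j (@tau n) x = (-1) ^+ (n * j) *: iter j
  cyc x.
Proof.
elim: j => [|j IH]; first by rewrite muln0 scale1r.
rewrite /= IH (linear_funZ (@tau_linear _)) signZZ.
by rewrite mulnS addnC.
Qed.

Lemma tau_order n (x : M n) : iter n.+1 (@tau n) x = x.
Proof.
rewrite iter_tauE cyc_order -[RHS]scale1r -(expr0 (-1)); apply: signZ_odd.
by rewrite oddM /=; case: odd.
Qed.

Lemma sact_lt p q n l l' m i j (f : O p) (g : O q) (x : M n) :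
  (l + q)%N = n.+1 -> (l' + p)%N = n.+1 -> (m + p)%N = l.+1 ->
  (j < i)%N -> (i <= m)%N -> (j <= l)%N ->
  sact m i f (sact l j g x)
  = (-1) ^+ (p.+1 * q.+1) *: sact m j g (sact l' (i + q).-1 f x).
Proof.
move=> dl dl' dm ji im jl; rewrite /sact.
rewrite !(linear_funZ (@act_linearr _ _ _ _ _ _ _ _)) !signZZ (act_lt (l' :=
  l')) //.
by apply: signZ_odd; case: i ji {im} => // i _; rewrite addSn; parity.
Qed.

Lemma sact_mid p q n l r m i j (f : O p) (g : O q) (x : M n) :
  (l + q)%N = n.+1 -> r.+1 = (p + q)%N -> (m + p)%N = l.+1 ->
  (i <= j)%N -> (j < i + p)%N -> (j <= l)%N -> (i <= m)%N ->
  sact m i f (sact l j g x) = sact m i (tcirc r (j - i) f g) x.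
Proof.
move=> dl dr dm ij jp jl im; rewrite /sact /tcirc.
rewrite (linear_funZ (@act_linearr _ _ _ _ _ _ _ _)).
rewrite (linear_funZ (@act_linearl _ _ _ _ _ _ _ _)) !signZZ (act_mid (r :=
  r)) //.
apply: signZ_odd; have -> : j = (i + (j - i))%N by lia.
by rewrite addKn dr; parity.
Qed.

Lemma sact_ge p q n l l' m i j (f : O p) (g : O q) (x : M n) :
  (l + q)%N = n.+1 -> (l' + p)%N = n.+1 -> (m + p)%N = l.+1 ->
  (i + p <= j)%N -> (j <= l)%N -> (i <= m)%N ->
  sact m i f (sact l j g x)
  = (-1) ^+ (p.+1 * q.+1) *: sact m (j - p).+1 g (sact l' i f x).
Proof.
move=> dl dl' dm ji jl im; rewrite /sact.
rewrite !(linear_funZ (@act_linearr _ _ _ _ _ _ _ _)) !signZZ (act_ge (l' :=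
  l')) //.
apply: signZ_odd; have -> : j = (p + (j - p))%N by lia.
by rewrite addKn; parity.
Qed.

Lemma tau_sact p n m i (f : O p) (x : M n) :
  (m + p)%N = n.+1 -> (i < m)%N ->
  tau (sact m i f x) = sact m i.+1 f (tau x).
Proof.
move=> d im; rewrite /sact /tau (linear_funZ (@cyc_linear _ _ _ _)).
rewrite (linear_funZ (@act_linearr _ _ _ _ _ _ _ _)) !signZZ cyc_act //.
by apply: signZ_odd; have := congr1 odd d; parity.
Qed.

Lemma iter_tau_sact p n m i j (f : O p) (x : M n) :
  (m + p)%N = n.+1 -> (i + j <= m)%N ->
  iter j (@tau _) (sact m i f x) = sact m (i + j) f (iter j (@tau _) x).
Proof.
move=> d; elim: j => [|j IH] ijm; first by rewrite addn0.
by rewrite /= IH ?tau_sact ?addnS //; lia.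
Qed.

(* [f] then covers the last [q] positions of [x], which [tau ^ q] moves to the
   front. *)
Lemma tau_sact_last q n m (f : O q) (x : M n) :
  (m + q)%N = n.+1 ->
  tau (sact m m f x) = sact m 0 f (iter q (@tau _) x).
Proof.
move=> d; set y := iter q _ x.
(* Since m + q = n + 1, x is tau^m y. Inserting f at position m of tau^m y is tau^m of inserting it
   at position 0 of y, and one more rotation closes the cycle on M(m). *)
have -> : x = iter m (@tau _) y by rewrite -iterD d tau_order.
have /= <- := iter_tau_sact (i := 0) (j := m) f y d (leqnn m).
by rewrite -iterS tau_order.
Qed.

(* [f] covers position 0 of [x] with its slot [j], counted from 0. *)
Definition wact p n m j (f : O p) (x : M n) : M m := sact m 0 f (iter j (@tau
  _) x).

Lemma wact_linearl p n m j (x : M n) : linear (fun f : O p => wact m j f x).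
Proof. exact: sact_linearl. Qed.

Lemma wact_linearr p n m j (f : O p) : linear (fun x : M n => wact m j f x).
Proof. by move=> a u v; rewrite /wact iter_tau_linear sact_linearr. Qed.

(** The operation g covers position 0 with its slot i and sits in slot j of f, so the composite
    covers position 0 with slot i + j. *)
Lemma wact_wact p q n l r m i j (f : O p) (g : O q) (x : M n) :
  (l + q)%N = n.+1 -> r.+1 = (p + q)%N -> (m + p)%N = l.+1 -> (j < p)%N ->
  wact m j f (wact l i g x) = wact m (i + j) (tcirc r j f g) x.
Proof.
move=> dl dr dm jp; rewrite /wact iter_tau_sact //; last by lia.
by rewrite add0n (sact_mid (r := r)) ?subn0 -?iterD //; (try lia); rewrite
  addnC.
Qed.

(** The rotation tau^j carries g from position i to i + j. This and the next two lemmas treat the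
    cases where i + j is a slot of f, lies beyond f, or exceeds l and wraps around. *)
Lemma wact_sact_right p q n l r m i j (f : O p) (g : O q) (x : M n) :
  (l + q)%N = n.+1 -> r.+1 = (p + q)%N -> (m + p)%N = l.+1 -> (i + j < p)%N ->
  wact m j f (sact l i g x) = wact m j (tcirc r (i + j) f g) x.
Proof.
move=> dl dr dm jp; rewrite /wact iter_tau_sact //; last by lia.
by rewrite (sact_mid (r := r)) ?subn0 //; lia.
Qed.

Lemma wact_sact_outside p q n l l' m i j (f : O p) (g : O q) (x : M n) :
  (l + q)%N = n.+1 -> (l' + p)%N = n.+1 -> (m + p)%N = l.+1 ->
  (p <= i + j)%N -> (i + j <= l)%N ->
  wact m j f (sact l i g x)
  = (-1) ^+ (p.+1 * q.+1) *: sact m (i + j - p).+1 g (wact l' j f x).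
Proof.
move=> dl dl' dm pij ijl; rewrite /wact iter_tau_sact //.
by rewrite (sact_ge (l' := l')) //; lia.
Qed.

(** After wrapping around, g sits in a slot of f to the left of slot j. It brings q inputs in place
    of one, which moves position 0 to slot j + q - 1. *)
Lemma wact_sact_left p q n l r m i j (f : O p) (g : O q) (x : M n) :
  (l + q)%N = n.+1 -> r.+1 = (p + q)%N -> (m + p)%N = l.+1 -> (j < p)%N ->
  (l < i + j)%N -> (i <= l)%N ->
  wact m j f (sact l i g x) = wact m (j + q).-1 (tcirc r (i + j - l).-1 f g) x.
Proof.
move=> dl dr dm jp ijl il; rewrite /wact.
(* The first l - i rotations bring g to the last position l, the next one wraps it to the front, and
   the remaining ones move it to its slot of f. *)
have -> : j = ((i + j - l).-1 + (l - i).+1)%N by lia.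
rewrite iterD iterS iter_tau_sact //; last by lia.
rewrite subnKC // tau_sact_last // iter_tau_sact //; last by lia.
rewrite (sact_mid (r := r)) ?subn0 -?iterD //; try by lia.
by congr (sact m 0 (tcirc r _ f g) (iter _ _ _)); lia.
Qed.

End SignedModule.

(** * The two halves of the Lie derivative *)

Lemma sum_nat_shift (V : nmodType) a n (F : nat -> V) :
  \sum_(a <= i < n) F i = \sum_(0 <= i < n - a) F (i + a)%N.
Proof. by rewrite -{1}[a]add0n big_addn. Qed.

Section LieOperator.
Variables (k : comPzRingType) (O : operad k) (M : cyclic_module O).

(** This is A_f, and [wact_sum] is B_f; by [lieE] their sum is the Lie derivative up to the sign
    (-1)^(p-1). *)
Definition act_sum p n m (f : O p) (x : M n) : M m :=
  \sum_(0 <= i < m) sact m i.+1 f x.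

Definition wact_sum p n m (f : O p) (x : M n) : M m :=
  \sum_(0 <= j < p) wact m j f x.

Definition lie_sum p n m (f : O p) (x : M n) : M m := act_sum m f x + wact_sum
  m f x.

Lemma act_sum_linearr p n m (f : O p) : linear (fun x : M n => act_sum m f x).
Proof.
move=> a u v; rewrite /act_sum scaler_sumr -big_split; apply: eq_bigr => i _.
exact: sact_linearr.
Qed.

Lemma act_sum_linearl p n m (x : M n) : linear (fun f : O p => act_sum m f x).
Proof.
move=> a u v; rewrite /act_sum scaler_sumr -big_split; apply: eq_bigr => i _.
exact: sact_linearl.
Qed.

Lemma wact_sum_linearr p n m (f : O p) : linear (fun x : M n => wact_sum m f x).
Proof.
move=> a u v; rewrite /wact_sum scaler_sumr -big_split; apply: eq_bigr => i _.
exact: wact_linearr.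
Qed.

Lemma wact_sum_linearl p n m (x : M n) : linear (fun f : O p => wact_sum m f x).
Proof.
move=> a u v; rewrite /wact_sum scaler_sumr -big_split; apply: eq_bigr => i _.
exact: wact_linearl.
Qed.

Lemma lie_sum_linearr p n m (f : O p) : linear (fun x : M n => lie_sum m f x).
Proof.
by move=> a u v; rewrite /lie_sum act_sum_linearr wact_sum_linearr scalerDr
  addrACA.
Qed.

Lemma lie_sum_linearl p n m (x : M n) : linear (fun f : O p => lie_sum m f x).
Proof.
by move=> a u v; rewrite /lie_sum act_sum_linearl wact_sum_linearl scalerDr
  addrACA.
Qed.

End LieOperator.

(** * Products and graded commutators of Lie derivatives *)

Section LieCommutator.
Variables (k : comPzRingType) (O : operad k) (M : cyclic_module O).

(** As the position of g grows, g runs through the slots of f to the right of j, then through the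
    positions outside f, then, wrapped around, through the slots to the left of j. *)
Lemma wact_act_sum p q n l l' r m j (f : O p) (g : O q) (x : M n) :
  (l + q)%N = n.+1 -> l' = (n.+1 - p)%N -> r.+1 = (p + q)%N ->
  (m + p)%N = l.+1 -> (j < p)%N ->
  wact m j f (act_sum l g x)
  = \sum_(j.+1 <= s < p) wact m j (tcirc r s f g) x
    + (-1) ^+ (p.+1 * q.+1) *: act_sum m g (wact l' j f x)
    + \sum_(0 <= s < j) wact m (j + q).-1 (tcirc r s f g) x.
Proof.
move=> dl dl' dr dm jp; rewrite /act_sum.
rewrite (linear_fun_sum (@wact_linearr _ _ _ _ _ _ _ _)).
rewrite (@big_cat_nat _ _ _ (l - j)%N) ?(@big_cat_nat _ _ _ (p - j.+1)%N 0 (l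
  - j)) /=;
  try by lia.
congr (_ + _ + _).
- rewrite [RHS]sum_nat_shift; apply: eq_big_nat => i ip.
  by rewrite (wact_sact_right (r := r)) ?addSnnS //; lia.
- rewrite [LHS]sum_nat_shift scaler_sumr.
  have -> : (l - j - (p - j.+1))%N = m by lia.
  apply: eq_big_nat => i im.
  rewrite (wact_sact_outside (l' := l')) //; try by lia.
  by congr (_ *: sact _ _ _ _); lia.
- rewrite [LHS]sum_nat_shift; have -> : (l - (l - j))%N = j by lia.
  apply: congr_big_nat => // s sj.
  rewrite (wact_sact_left (r := r)) //; try by lia.
  by congr (wact _ _ (tcirc _ _ _ _) _); lia.
Qed.

(** Either g lies in a slot of f, or to the right of f, or to its left. Exchanging f and g exchanges
    the two double sums, so these cancel in the graded commutator. *)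
Lemma act_sum_act_sum p q n l l' r m (f : O p) (g : O q) (x : M n) :
  (m + (p + q))%N = n.+2 -> l = (n.+1 - q)%N -> l' = (n.+1 - p)%N ->
  r = (p + q).-1 ->
  act_sum m f (act_sum l g x)
  = act_sum m (circ_bar r f g) x
    + \sum_(0 <= i < m) \sum_(i.+1 <= j < m) sact m i.+1 f (sact l (j + p) g x)
    + (-1) ^+ (p.+1 * q.+1) *: \sum_(0 <= i < m) \sum_(i.+1 <= j < m)
        sact m i.+1 g (sact l' (j + q) f x).
Proof.
move=> dm dl dl' dr; rewrite [X in _ + _ *: X]sum_nat_sum_lt.
rewrite {1 2}/act_sum scaler_sumr -!big_split; apply: eq_big_nat => i im /=.
rewrite /act_sum (linear_fun_sum (@sact_linearr _ _ _ _ _ _ _ _)).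
rewrite (@big_cat_nat _ _ _ (i + p)%N) ?(@big_cat_nat _ _ _ i 0 (i + p)) /=;
  try by lia.
rewrite -addrA addrC; congr (_ + _ + _).
- rewrite circ_barE (linear_fun_sum (@sact_linearl _ _ _ _ _ _ _ _)).
  rewrite [LHS]sum_nat_shift addKn; apply: eq_big_nat => s sp.
  by rewrite (sact_mid (r := r)) ?subSS ?addnK //; lia.
- rewrite [LHS]sum_nat_shift [RHS]sum_nat_shift.
  have -> : (m - i.+1)%N = (l - (i + p))%N by lia.
  by apply: eq_big_nat => s sp; congr (sact _ _ _ (sact _ _ _ _)); lia.
- rewrite scaler_sumr; apply: eq_big_nat => j ji.
  by rewrite (sact_lt (l' := l')) //; lia.
Qed.

Lemma wact_sum_wact_sum p q n l r m (f : O p) (g : O q) (x : M n) :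
  (m + (p + q))%N = n.+2 -> l = (n.+1 - q)%N -> r = (p + q).-1 ->
  wact_sum m f (wact_sum l g x)
  = \sum_(0 <= j < p) \sum_(0 <= i < q) wact m (i + j) (tcirc r j f g) x.
Proof.
move=> dm dl dr; apply: eq_big_nat => j jp; rewrite /wact_sum.
rewrite (linear_fun_sum (@wact_linearr _ _ _ _ _ _ _ _)).
by apply: eq_big_nat => i iq; rewrite (wact_wact (r := r)) //; lia.
Qed.

Lemma wact_sum_circ_bar p q n l l' r m (f : O p) (g : O q) (x : M n) :
  (m + (p + q))%N = n.+2 -> l = (n.+1 - q)%N -> l' = (n.+1 - p)%N ->
  r = (p + q).-1 ->
  wact_sum m (circ_bar r f g) x
  = wact_sum m f (act_sum l g x)
    - (-1) ^+ (p.+1 * q.+1) *: act_sum m g (wact_sum l' f x) + wact_sum m f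
    (wact_sum l g x).
Proof.
move=> dm dl dl' dr; rewrite (wact_sum_wact_sum (r := r)) //.
rewrite {3}/wact_sum (linear_fun_sum (@act_sum_linearr _ _ _ _ _ _ _))
  scaler_sumr.
rewrite {2}/wact_sum -sumrB -big_split /=.
under [RHS]eq_big_nat => j jp.
  rewrite (wact_act_sum (l' := l') (r := r)) //; try by lia.
  rewrite [X in X - _]addrAC addrK; over.
rewrite !big_split /= sum_nat_sum_lt -(sum_nat_sum_lt _ _ (fun s j =>
  wact m (j + q).-1 (tcirc r s f g) x)) -!big_split /=.
rewrite /wact_sum circ_barE.
under [LHS]eq_bigr => j _ do rewrite (linear_fun_sum (@wact_linearl _ _ _ _ _
  _ _ _)).
rewrite exchange_big_nat /=; apply: eq_big_nat => s sp.
(* With g in slot s of f, the slots s, ..., s + q - 1 of the composite are those of g. *)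
rewrite (@big_cat_nat _ _ _ (s + q)%N) ?(@big_cat_nat _ _ _ s 0 (s + q)) /=;
  try by lia.
rewrite addrAC; congr (_ + _ + _).
  rewrite [LHS]sum_nat_shift [RHS]sum_nat_shift.
  have -> : (p - s.+1)%N = (r - (s + q))%N by lia.
  by apply: eq_big_nat => j jr; congr (wact _ _ _ _); lia.
by rewrite [LHS]sum_nat_shift addKn.
Qed.

(** For g = mu, where [lie_sum] is the boundary by [bdryE], this makes Lie derivatives along
    cocycles commute with b up to sign. *)
Lemma lie_sum_commutator p q n l l' r m (f : O p) (g : O q) (x : M n) :
  (m + (p + q))%N = n.+2 -> l = (n.+1 - q)%N -> l' = (n.+1 - p)%N ->
  r = (p + q).-1 ->
  lie_sum m f (lie_sum l g x) - (-1) ^+ (p.+1 * q.+1) *: lie_sum m g (lie_sum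
    l' f x)
  = lie_sum m (circ_bar r f g - (-1) ^+ (p.+1 * q.+1) *: circ_bar r g f) x.
Proof.
move=> dm dl dl' dr.
have dm' : (m + (q + p))%N = n.+2 by rewrite (addnC q).
have dr' : r = (q + p).-1 by rewrite (addnC q).
rewrite -!scaleNr (linear_funD (@lie_sum_linearl _ _ _ _ _ _ _)).
rewrite (linear_funZ (@lie_sum_linearl _ _ _ _ _ _ _)) !scaleNr /lie_sum.
rewrite (wact_sum_circ_bar f g x dm dl dl' dr) (wact_sum_circ_bar g f x dm'
  dl' dl dr').
rewrite !(linear_funD (@act_sum_linearr _ _ _ _ _ _ _)).
rewrite !(linear_funD (@wact_sum_linearr _ _ _ _ _ _ _)).
rewrite (act_sum_act_sum f g x dm dl dl' dr) (act_sum_act_sum g f x dm' dl' dl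
  dr').
rewrite (mulnC q.+1); sign_module.
Qed.
End LieCommutator.

(** * The homotopy R(f, g) and its expansions *)

Section Insertion.
Variables (k : comPzRingType) (O : operad k) (mu : O 2%N) (M : cyclic_module O).

(* [f] covers position 0, and [g] sits in a slot of [f] to the right of it. *)
Definition right_ins p q n r m (f : O p) (g : O q) (x : M n) : M m :=
  \sum_(0 <= j < p) \sum_(j.+1 <= s < p) wact m j (tcirc r s f g) x.

(** By [capE] this is the cap product up to the sign (-1)^(q-1). *)
Definition scap q n m (g : O q) (x : M n) : M m := wact m 0 (tcirc q.+1 1 mu
  g) x.

Lemma scap_linearr q n m (g : O q) : linear (fun x : M n => scap m g x).
Proof. exact: wact_linearr. Qed.

Lemma scap_linearl q n m (x : M n) : linear (fun g : O q => scap m g x).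
Proof. by move=> a u v; rewrite /scap tcirc_linearr wact_linearl. Qed.

Lemma right_ins_linearl p q n r m (g : O q) (x : M n) :
  linear (fun f : O p => right_ins r m f g x).
Proof.
move=> a u v; rewrite /right_ins scaler_sumr -big_split; apply: eq_bigr => j _.
rewrite scaler_sumr -big_split; apply: eq_bigr => s _.
by rewrite tcirc_linearl wact_linearl.
Qed.

Lemma right_ins_linearm p q n r m (f : O p) (x : M n) :
  linear (fun g : O q => right_ins r m f g x).
Proof.
move=> a u v; rewrite /right_ins scaler_sumr -big_split; apply: eq_bigr => j _.
rewrite scaler_sumr -big_split; apply: eq_bigr => s _.
by rewrite tcirc_linearr wact_linearl.
Qed.

Lemma right_ins_linearr p q n r m (f : O p) (g : O q) :
  linear (fun x : M n => right_ins r m f g x).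
Proof.
move=> a u v; rewrite /right_ins scaler_sumr -big_split; apply: eq_bigr => j _.
rewrite scaler_sumr -big_split; apply: eq_bigr => s _.
exact: wact_linearr.
Qed.

Lemma circ_bar2 p r (f : O p) : circ_bar r mu f = tcirc r 0 mu f + tcirc r 1
  mu f.
Proof. by rewrite circ_barE 2?big_nat_recr //= big_nil add0r. Qed.

Lemma wact_sum2 n m (x : M n) : wact_sum m mu x = wact m 0 mu x + wact m 1 mu x.
Proof. by rewrite /wact_sum 2?big_nat_recr //= big_nil add0r. Qed.

(** Position 0 is in the first slot of mu o_2 g, so nothing fits to its left: f lands either in a
    slot of g or outside. *)
Lemma scap_act_sum p q n l l' r m (f : O p) (g : O q) (x : M n) :
  (m + (p + q))%N = n.+1 -> l = (n.+1 - p)%N -> l' = (n - q)%N ->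
  r = (p + q).-1 ->
  scap m g (act_sum l f x)
  = scap m (circ_bar r g f) x
    + (-1) ^+ (q * p.+1) *: act_sum m f (scap l' g x).
Proof.
move=> dm dl dl' dr; rewrite /scap.
have -> : (-1) ^+ (q * p.+1) *: act_sum m f (wact l' 0 (tcirc q.+1 1 mu g) x)
  = (-1) ^+ (q.+2 * p.+1) *: act_sum m f (wact l' 0 (tcirc q.+1 1 mu g) x).
  by apply: signZ_odd; parity.
case: q g dm dl' dr => [|q] g dm dl' dr.
  (* For q = 0 the degree [r] may be truncated, but the sum over the slots of g is empty. *)
  rewrite (wact_act_sum (l' := l') (r := p)) //; try by lia.
  rewrite circ_barE !big_geq // addr0 (linear_fun0 (@tcirc_linearr _ _ _ _ _ _
    _)).
  by rewrite (linear_fun0 (@wact_linearl _ _ _ _ _ _ _ _)).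
rewrite (wact_act_sum (l' := l') (r := r.+1)) //; try by lia.
rewrite [X in _ + X]big_geq // addr0; congr (_ + _).
rewrite circ_barE (linear_fun_sum (@tcirc_linearr _ _ _ _ _ _ _)).
rewrite (linear_fun_sum (@wact_linearl _ _ _ _ _ _ _ _)).
rewrite [LHS]sum_nat_shift subn1 /=; apply: eq_big_nat => s sq.
by rewrite (tcirc_mid (b := r)) ?addnK //; lia.
Qed.

(** With f in the first slot of mu, f covers position 0 and g lies in f or in the second slot of mu,
    giving R(f, g) or iota_g B_f. With f in the second slot, g lies in f, and position 0 is in f or
    in the first slot of mu, giving R(f, g) or iota_(f o g). *)
Lemma right_ins_mu_circ_bar p q n l m (f : O p) (g : O q) (x : M n) :
  (m + (p + q))%N = n.+1 -> l = (n.+1 - p)%N ->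
  right_ins (p + q) m (circ_bar p.+1 mu f) g x
  = wact_sum m mu (right_ins (p + q).-1 m.+1 f g x)
    + (-1) ^+ (p.+1 * q.+1) *: scap m g (wact_sum l f x)
    + scap m (circ_bar (p + q).-1 f g) x.
Proof.
(* For p = 0 every term vanishes: mu o f has a single slot, and f has none. *)
case: p f => [|p] f dm dl.
  have -> : circ_bar (0 + q).-1 f g = 0 by rewrite circ_barE big_geq.
  have -> : wact_sum l f x = 0 by rewrite /wact_sum big_geq.
  have -> : right_ins (0 + q).-1 m.+1 f g x = 0 by rewrite /right_ins big_geq.
  rewrite (linear_fun0 (@scap_linearl _ _ _ _)) (linear_fun0 (@scap_linearr _
    _ _ _)).
  rewrite (linear_fun0 (@wact_sum_linearr _ _ _ _ _ _ _)) scaler0 !addr0.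
  by rewrite /right_ins big_nat1 big_geq.
rewrite circ_bar2 (linear_funD (@right_ins_linearl _ _ _ _ _ _ _)) wact_sum2.
have -> : right_ins (p.+1 + q) m (tcirc p.+2 0 mu f) g x
  = wact m 0 mu (right_ins (p.+1 + q).-1 m.+1 f g x)
    + (-1) ^+ (p.+2 * q.+1) *: scap m g (wact_sum l f x).
  rewrite /right_ins big_nat_recr //= [X in _ + X]big_geq // addr0 /wact_sum.
  rewrite (linear_fun_sum (@wact_linearr _ _ _ _ _ _ _ _)).
  rewrite (linear_fun_sum (@scap_linearr _ _ _ _)) scaler_sumr -big_split.
  apply: eq_big_nat => j jp /=; rewrite big_nat_recr //=.
  rewrite (linear_fun_sum (@wact_linearr _ _ _ _ _ _ _ _)).
  congr (_ + _).
    apply: eq_big_nat => s sp.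
    rewrite (wact_wact (r := (p.+1 + q)%N)) //; try by lia.
    rewrite addn0; congr (wact _ _ _ _).
    by rewrite (tcirc_mid (b := (p + q)%N)) ?subn0 //; lia.
  rewrite (tcirc_ge (b := q.+1)) //; try by lia.
  rewrite (linear_funZ (@wact_linearl _ _ _ _ _ _ _ _)) /scap.
  rewrite (wact_wact (r := (p.+1 + q)%N)) //; try by lia.
  by rewrite addn0 subSnn.
have -> : right_ins (p.+1 + q) m (tcirc p.+2 1 mu f) g x
  = wact m 1 mu (right_ins (p.+1 + q).-1 m.+1 f g x)
    + scap m (circ_bar (p.+1 + q).-1 f g) x; last by zmodule.
rewrite /right_ins big_nat_recl // addrC; congr (_ + _).
  rewrite (linear_fun_sum (@wact_linearr _ _ _ _ _ _ _ _)).
  apply: eq_big_nat => j jp; rewrite big_add1 /=.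
  rewrite (linear_fun_sum (@wact_linearr _ _ _ _ _ _ _ _)).
  apply: eq_big_nat => s sp.
  rewrite (wact_wact (r := (p.+1 + q)%N)) //; try by lia.
  rewrite addn1; congr (wact _ _ _ _).
  by rewrite (tcirc_mid (b := (p + q)%N)) ?subSS ?subn0 //; lia.
rewrite big_add1 /= circ_barE (linear_fun_sum (@scap_linearl _ _ _ _)).
apply: eq_big_nat => s sp; rewrite /scap.
by rewrite (tcirc_mid (b := (p + q)%N)) ?subSS ?subn0 //; lia.
Qed.

(** A mu in a slot u > j of f o_s g leaves position 0 in slot j, and one in a slot u < j moves it to
    j + 1. For u = j both occur, from the two slots of mu, hence the overlapping ranges. The last
    term has mu outside. *)
Lemma right_ins_lie_sum_mu p q n r m (f : O p) (g : O q) (x : M n) :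
  (m + (p + q))%N = n.+1 -> r = (p + q).-1 ->
  right_ins r m f g (lie_sum n.-1 mu x)
  = \sum_(0 <= j < p) \sum_(j.+1 <= s < p)
      (\sum_(j <= u < r) wact m j (tcirc (p + q) u (tcirc r s f g) mu) x
       + \sum_(0 <= u < j.+1)
           wact m j.+1 (tcirc (p + q) u (tcirc r s f g) mu) x)
    + (-1) ^+ (p + q) *: act_sum m mu (right_ins r m.+1 f g x).
Proof.
move=> dm dr; rewrite /right_ins (linear_fun_sum (@act_sum_linearr _ _ _ _ _ _
  _)).
rewrite scaler_sumr -big_split; apply: eq_big_nat => j jp /=.
rewrite (linear_fun_sum (@act_sum_linearr _ _ _ _ _ _ _)).
rewrite scaler_sumr -big_split; apply: eq_big_nat => s sp /=.
rewrite /lie_sum (linear_funD (@wact_linearr _ _ _ _ _ _ _ _)) wact_sum2.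
rewrite (linear_funD (@wact_linearr _ _ _ _ _ _ _ _)).
rewrite (wact_act_sum (l' := m.+1) (r := (p + q)%N)) //; try by lia.
rewrite !(wact_wact (r := (p + q)%N)) //; try by lia.
rewrite big_ltn ?(@big_nat_recr _ _ _ j) //=; last by lia.
rewrite addn2 add0n add1n /=.
have -> : (-1) ^+ (r.+1 * 3) *: act_sum m mu (wact m.+1 j (tcirc r s f g) x)
   = (-1) ^+ (p + q) *: act_sum m mu (wact m.+1 j (tcirc r s f g) x).
  by apply: signZ_odd; rewrite dr prednK; [parity|lia].
by zmodule.
Qed.

(** If g lies in a slot of mu, the term belongs to B_f iota_g when position 0 is in the other slot
    of mu, and to R(f, mu o g) when it is not in mu. Otherwise g and mu occupy different slots of f
    and may be exchanged; these terms form R(f, g) b without those where mu lies outside f or inside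
    g. *)
Lemma right_ins_circ_bar_mu p q n l m (f : O p) (g : O q) (x : M n) :
  (m + (p + q))%N = n.+1 -> l = (n - q)%N ->
  right_ins (p + q) m (circ_bar p.+1 f mu) g x
  = (-1) ^+ q.+1 *: (right_ins (p + q).-1 m f g (lie_sum n.-1 mu x)
      - (-1) ^+ (p + q) *: act_sum m mu (right_ins (p + q).-1 m.+1 f g x)
      - right_ins (p + q) m f (circ_bar q.+1 g mu) x)
    + right_ins (p + q) m f (circ_bar q.+1 mu g) x + wact_sum m f (scap l g x).
Proof.
move=> dm dl; rewrite (right_ins_lie_sum_mu (r := (p + q).-1)) //.
rewrite addrK.
(* Position 0 is in slot j throughout. [K] inserts mu before g, [H] inserts g before mu, and [G] has
   g inside mu; the three facts below rewrite [K] as [H] or [G] according to where g lies relative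
   to mu. *)
pose H j s u := wact m j (tcirc (p + q) u (tcirc (p + q).-1 s f g) mu) x.
pose G j a v := wact m j (tcirc (p + q) a f (tcirc q.+1 v mu g)) x.
pose K j a s := wact m j (tcirc (p + q) s (tcirc p.+1 a f mu) g) x.
have Klt j a s : (s < a < p)%N -> K j a s = (-1) ^+ q.+1 *: H j s (a + q).-1.
  move=> asp; rewrite /K /H (tcirc_lt (b := (p + q).-1)) //; try by lia.
  rewrite (linear_funZ (@wact_linearl _ _ _ _ _ _ _ _)).
  by apply: signZ_odd; parity.
have Kge j a s : (a < s < p)%N -> K j a s.+1 = (-1) ^+ q.+1 *: H j s a.
  move=> asp; rewrite /K /H (tcirc_ge (b := (p + q).-1)) //; try by lia.
  rewrite (linear_funZ (@wact_linearl _ _ _ _ _ _ _ _)) subSS subn1 /=.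
  by apply: signZ_odd; parity.
have Kmid j a v : (a < p)%N -> (v < 2)%N -> K j a (v + a)%N = G j a v.
  by move=> ap v2; rewrite /K /G (tcirc_mid (b := q.+1)) ?addnK //; lia.
have -> : right_ins (p + q) m (circ_bar p.+1 f mu) g x
  = \sum_(0 <= j < p) \sum_(0 <= a < p) \sum_(j.+1 <= s < p.+1) K j a s.
  rewrite /right_ins big_nat_recr //= [X in _ + X]big_geq // addr0.
  apply: eq_big_nat => j jp; rewrite circ_barE exchange_big_nat /=.
  apply: eq_big_nat => s sp.
  rewrite (linear_fun_sum (@tcirc_linearl _ _ _ _ _ _ _)).
  by rewrite (linear_fun_sum (@wact_linearl _ _ _ _ _ _ _ _)).
have -> : wact_sum m f (scap l g x) = \sum_(0 <= j < p) G j j 1%N.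
  apply: eq_big_nat => j jp.
  by rewrite /scap (wact_wact (r := (p + q)%N)) //; lia.
have -> : right_ins (p + q) m f (circ_bar q.+1 mu g) x
  = \sum_(0 <= j < p) \sum_(j.+1 <= a < p) (G j a 0%N + G j a 1%N).
  apply: eq_big_nat => j jp; apply: eq_big_nat => a ap.
  rewrite circ_bar2 (linear_funD (@tcirc_linearr _ _ _ _ _ _ _)).
  exact: (linear_funD (@wact_linearl _ _ _ _ _ _ _ _)).
have -> : right_ins (p + q) m f (circ_bar q.+1 g mu) x
  = \sum_(0 <= j < p) \sum_(j.+1 <= s < p) \sum_(s <= u < s + q) H j s u.
  apply: eq_big_nat => j jp; apply: eq_big_nat => s sp.
  rewrite circ_barE (linear_fun_sum (@tcirc_linearr _ _ _ _ _ _ _)).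
  rewrite (linear_fun_sum (@wact_linearl _ _ _ _ _ _ _ _)).
  rewrite [RHS]sum_nat_shift addKn; apply: eq_big_nat => v vq.
  by rewrite /H (tcirc_mid (b := q.+1)) ?addnK //; lia.
set r := (p + q).-1 in H Klt Kge *.
have -> : \sum_(0 <= j < p) \sum_(j.+1 <= s < p)
    (\sum_(j <= u < r) wact m j (tcirc (p + q) u (tcirc r s f g) mu) x
     + \sum_(0 <= u < j.+1) wact m j.+1 (tcirc (p + q) u (tcirc r s f g) mu) x)
  - \sum_(0 <= j < p) \sum_(j.+1 <= s < p) \sum_(s <= u < s + q) H j s u
  = \sum_(0 <= j < p) \sum_(j.+1 <= s < p)
      (\sum_(j <= u < s) H j s u + \sum_(s + q <= u < r) H j s u)
    + \sum_(0 <= j < p) \sum_(0 <= a < j) \sum_(j <= s < p) H j s a.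
  (* The terms with position 0 in slot j + 1 are reindexed by that slot; this loses nothing because
     [E] is an empty sum at both ends 0 and p. *)
  pose E j := \sum_(0 <= a < j) \sum_(j <= s < p) H j s a.
  have -> : \sum_(0 <= j < p) E j = \sum_(0 <= j < p) E j.+1.
    have E0 : E 0%N = 0 by rewrite /E big_geq.
    have Ep : E p = 0 by rewrite /E big1 // => a _; rewrite big_geq.
    transitivity (\sum_(0 <= j < p.+1) E j).
      by rewrite big_nat_recr //= Ep addr0.
    by rewrite big_nat_recl // E0 add0r.
  rewrite -sumrB -big_split; apply: eq_big_nat => j jp /=.
  rewrite /E exchange_big_nat /= -sumrB -big_split; apply: eq_big_nat => s sp
    /=.
  rewrite (@big_cat_nat _ _ _ (s + q)%N j) ?(@big_cat_nat _ _ _ s j (s + q)) /=;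
    try by rewrite /r; lia.
  rewrite -/(H _ _ _).
  by zmodule.
rewrite scalerDr !scaler_sumr -!big_split; apply: eq_big_nat => j jp /=.
(* The slot a of mu is left of j, equal to j, or right of j. For a = j, the first term has position
   0 and g in the two slots of mu and is the one of B_f iota_g. *)
rewrite (@big_cat_nat _ _ _ j) ?(@big_ltn _ _ _ j p) /=; try by lia.
rewrite (@big_ltn _ _ _ j.+1 p.+1) //.
rewrite -[K j j j.+1]/(K j j (1 + j)%N) Kmid //.
have -> : \sum_(0 <= a < j) \sum_(j.+1 <= s < p.+1) K j a s
  = (-1) ^+ q.+1 *: \sum_(0 <= a < j) \sum_(j <= s < p) H j s a.
  rewrite scaler_sumr; apply: eq_big_nat => a aj.
  rewrite big_add1 scaler_sumr; apply: eq_big_nat => s sp.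
  by apply: Kge; lia.
have -> : \sum_(j.+2 <= s < p.+1) K j j s
  = (-1) ^+ q.+1 *: \sum_(j.+1 <= s < p) H j s j.
  by rewrite big_add1 scaler_sumr; apply: eq_big_nat => s sp; apply: Kge; lia.
have -> : \sum_(j.+1 <= a < p) \sum_(j.+1 <= s < p.+1) K j a s
  = (-1) ^+ q.+1 *: \sum_(j.+1 <= a < p) \sum_(j.+1 <= s < a) H j s (a + q).-1
    + \sum_(j.+1 <= a < p) (G j a 0%N + G j a 1%N)
    + (-1) ^+ q.+1 *: \sum_(j.+1 <= a < p) \sum_(a.+1 <= s < p) H j s a.
  rewrite !scaler_sumr -!big_split; apply: eq_big_nat => a ap /=.
  rewrite (@big_cat_nat _ _ _ a) ?(@big_ltn _ _ _ a p.+1) /=; try by lia.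
  rewrite (@big_ltn _ _ _ a.+1 p.+1); last by lia.
  rewrite -(Kmid j a 0%N) -?(Kmid j a 1%N) //; try by lia.
  rewrite -!addrA; congr (_ + (_ + (_ + _))); rewrite ?big_add1 scaler_sumr.
    by apply: eq_big_nat => s sa; apply: Klt; lia.
  by apply: eq_big_nat => s sa; apply: Kge; lia.
have -> : \sum_(j.+1 <= s < p)
    (\sum_(j <= u < s) H j s u + \sum_(s + q <= u < r) H j s u)
  = \sum_(j.+1 <= s < p) H j s j
    + \sum_(j.+1 <= a < p) \sum_(a.+1 <= s < p) H j s a
    + \sum_(j.+1 <= a < p) \sum_(j.+1 <= s < a) H j s (a + q).-1.
  rewrite sum_nat_sum_lt -(sum_nat_sum_lt _ _ (fun s a => H j s (a + q).-1)).
  rewrite -!big_split; apply: eq_big_nat => s sp /=.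
  rewrite (@big_ltn _ _ _ j s); last by lia.
  congr (_ + _); rewrite [LHS]sum_nat_shift [RHS]sum_nat_shift.
  have -> : (r - (s + q))%N = (p - s.+1)%N by rewrite /r; lia.
  by apply: eq_big_nat => u up; congr (H _ _ _); lia.
rewrite !scalerDr; by zmodule.
Qed.

End Insertion.

(** * The homotopy formula on cycles *)

Section Homotopy.
Variables (k : comPzRingType) (O : operad k) (mu : O 2%N) (M : cyclic_module O).

(** The two nonzero cases of [lie] merge: if p = n + 1 then m = 0, so A_f is empty, and N consists
    of exactly the p rotations in B_f. *)
Lemma lieE p n m (f : O p) (x : M n) :
  (m + p)%N = n.+1 -> lie m f x = (-1) ^+ p.+1 *: lie_sum m f x.
Proof.
move=> d; rewrite /lie /lie_sum scalerDr /act_sum /wact_sum !scaler_sumr.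
have [pn|np] := ltnP p n.+1.
  rewrite -d addnK !big_add1 /=; congr (_ + _); apply: eq_bigr => i _.
    by rewrite /sact signZZ subn1; apply: signZ_odd; parity.
  rewrite /wact /sact iter_tauE muln0 expr0 scale1r subn1 /=.
  rewrite (linear_funZ (@act_linearr _ _ _ _ _ _ _ _)) signZZ.
  by apply: signZ_odd; parity.
have pE : p = n.+1 by lia.
have mE : m = 0%N by lia.
subst p m.
rewrite eqxx (@big_geq _ _ _ 0 0) // add0r.
rewrite (linear_fun_sum (@act_linearr _ _ _ _ _ _ _ _)) scaler_sumr.
apply: eq_bigr => i _; rewrite /wact /sact iter_tauE muln0 expr0 scale1r.
by rewrite mulnC.
Qed.

Lemma lie_deg p n m (f : O p) (x : M n) : (m + p)%N <> n.+1 -> lie m f x = 0.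
Proof.
move=> d; rewrite /lie; case: ifP => _.
  by rewrite !big1 ?addr0 // => i _; rewrite act_deg // scaler0.
by case: ifP => // _; rewrite act_deg // scaler0.
Qed.

Lemma lie_linear p n m (f : O p) : linear (fun x : M n => lie m f x).
Proof.
have [/eqP d|/eqP d] := boolP ((m + p)%N == n.+1) => a u v.
  by rewrite !lieE // lie_sum_linearr scalerDr !scalerA [_ * a]mulrC.
by rewrite !lie_deg // scaler0 addr0.
Qed.

Lemma capE q n m (g : O q) (x : M n) :
  cap mu m g x = (-1) ^+ q.+1 *: scap mu m g x.
Proof.
rewrite /cap /scap /wact /sact /tcirc muln0 expr0 scale1r muln1 /=.
rewrite (linear_funZ (@act_linearl _ _ _ _ _ _ _ _)) signZZ -[LHS]scale1r
  -(expr0 (-1)).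
by apply: signZ_odd; parity.
Qed.

Lemma cap_linear q n m (g : O q) : linear (fun x : M n => cap mu m g x).
Proof.
by move=> a u v; rewrite !capE scap_linearr scalerDr !scalerA [_ * a]mulrC.
Qed.

Lemma cap_deg q n m (g : O q) (x : M n) : (m + q)%N <> n -> cap mu m g x = 0.
Proof. by move=> d; rewrite /cap act_deg //; lia. Qed.

(** The first and the last term of b form B_mu. In degree 0 both sides vanish by [act_deg]. *)
Lemma bdryE n (x : M n) : bdry mu x = lie_sum n.-1 mu x.
Proof.
rewrite /bdry /lie_sum wact_sum2 /act_sum; case: n x => [|n] x.
  by rewrite /wact /sact !act_deg // !scaler0 !big_geq // !addr0.
rewrite big_nat_recl // /wact /sact /tau /= ?muln0 ?expr0 ?scale1r.
rewrite (linear_funZ (@act_linearr _ _ _ _ _ _ _ _)) addrA [X in X + _]addrC.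
congr (_ + _ + _); apply: eq_bigr => i _; apply: signZ_odd.
by parity.
Qed.

Lemma bdry_0 (x : M 0) : bdry mu x = 0.
Proof. by rewrite /bdry big_geq // act_deg // scaler0 addr0. Qed.

Lemma cocycleE p (f : O p) :
  cobdry mu f = 0 -> circ_bar p.+1 mu f = (-1) ^+ p.+1 *: circ_bar p.+1 f mu.
Proof.
rewrite /cobdry /bracket => /eqP; rewrite subr_eq0 => /eqP ->.
by apply: signZ_odd; parity.
Qed.

Lemma bdry_lie_sum p n m (f : O p) (x : M n) :
  cobdry mu f = 0 -> (m.+1 + p)%N = n.+1 ->
  bdry mu (lie_sum m.+1 f x) = (-1) ^+ p.+1 *: lie_sum m f (bdry mu x).
Proof.
move=> /cocycleE fc d; rewrite !bdryE /=.
have dm : (m + (p + 2))%N = n.+2 by lia.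
have dl : n.-1 = (n.+1 - 2)%N by lia.
have dl' : m.+1 = (n.+1 - p)%N by lia.
have dr : p.+1 = (p + 2).-1 by lia.
have := lie_sum_commutator f mu x dm dl dl' dr; rewrite fc signZZ.
have -> : (-1) ^+ (p.+1 * 3 + p.+1) *: circ_bar p.+1 f mu = circ_bar p.+1 f mu.
  by rewrite -[RHS]scale1r -(expr0 (-1)); apply: signZ_odd; parity.
rewrite subrr (linear_fun0 (@lie_sum_linearl _ _ _ _ _ _ _)) => /eqP.
rewrite subr_eq0 => /eqP ->.
by sign_module.
Qed.

Lemma right_ins_mu q n r m (g : O q) (x : M n) :
  r = q.+1 -> right_ins r m mu g x = scap mu m g x.
Proof.
move=> ->; rewrite /right_ins 2?big_nat_recr //= big_nil add0r big_nat1.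
by rewrite big_geq // addr0.
Qed.

(** This is [right_ins_circ_bar_mu] for f = mu: R(mu, g) is the cap product, and mu o mu = 0 by
    associativity. *)
Lemma bdry_scap q n m (g : O q) (x : M n) e :
  multiplication mu e -> cobdry mu g = 0 -> (m.+1 + q)%N = n ->
  bdry mu (scap mu m.+1 g x) = (-1) ^+ q *: scap mu m g (bdry mu x).
Proof.
move=> [mu_assoc _ _] /cocycleE gc d; rewrite !bdryE /=.
have dm : (m + (2 + q))%N = n.+1 by lia.
have dl : m.+1 = (n - q)%N by lia.
have := right_ins_circ_bar_mu mu mu g x dm dl.
rewrite circ_bar2 /tcirc muln0 muln1 expr0 scale1r mu_assoc.
have -> : circ 2 mu mu + (-1) ^+ 3 *: circ 2 mu mu = 0 :> O 3%N by sign_module.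
rewrite (linear_fun0 (@right_ins_linearl _ _ _ _ _ _ _ _ _ _)) !right_ins_mu
  // gc.
rewrite (linear_funZ (@scap_linearl _ _ _ _ _ _ _ _)).
move: (lie_sum n.-1 mu x) => y E; apply: subr0_eq; rewrite [RHS]E /lie_sum.
by sign_module.
Qed.

(** The cocycle f identifies R(mu o f, g) with R(f o mu, g) up to sign, so the two expansions can be
    compared. The terms R(f, mu o g) and R(f, g o mu) cancel for the cocycle g, and R(f, g) b
    vanishes on the cycle x. *)
Lemma scap_lie_sum p q n l l' r m (f : O p) (g : O q) (x : M n) :
  cobdry mu f = 0 -> cobdry mu g = 0 -> bdry mu x = 0 ->
  (m + (p + q))%N = n.+1 -> l = (n.+1 - p)%N -> l' = (n - q)%N ->
  r = (p + q).-1 ->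
  scap mu m g (lie_sum l f x) - (-1) ^+ (q * p.+1) *: lie_sum m f (scap mu l'
    g x)
  = scap mu m (circ_bar r g f - (-1) ^+ (q.+1 * p.+1) *: circ_bar r f g) x
    - (-1) ^+ (p.+1 * q.+1) *: bdry mu (right_ins r m.+1 f g x).
Proof.
move=> /cocycleE fc /cocycleE gc; rewrite !bdryE => x0 dm dl dl' dr.
rewrite -!scaleNr (linear_funD (@scap_linearl _ _ _ _ _ _ _ _)).
rewrite (linear_funZ (@scap_linearl _ _ _ _ _ _ _ _)) !scaleNr.
rewrite {1 2}/lie_sum (linear_funD (@scap_linearr _ _ _ _ _ _ _ _)).
rewrite (scap_act_sum mu f g x dm dl dl' dr).
have := right_ins_mu_circ_bar mu f g x dm dl.
have := right_ins_circ_bar_mu mu f g x dm dl'.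
rewrite -dr fc gc x0 (linear_fun0 (@right_ins_linearr _ _ _ _ _ _ _ _ _ _)).
rewrite (linear_funZ (@right_ins_linearm _ _ _ _ _ _ _ _ _ _)).
rewrite (linear_funZ (@right_ins_linearl _ _ _ _ _ _ _ _ _ _)) => ->.
move: (wact_sum l f x) => y E.
(* The expansion of R(mu o f, g) in [E] is solved for iota_g B_f. *)
have -> : scap mu m g y = (-1) ^+ (p.+1 * q.+1) *: (wact_sum m mu (right_ins r
  m.+1 f g x)
    + (-1) ^+ (p.+1 * q.+1) *: scap mu m g y + scap mu m (circ_bar r f g) x
    - wact_sum m mu (right_ins r m.+1 f g x) - scap mu m (circ_bar r f g) x).
move: (scap mu m g y) (scap mu m _ x) (wact_sum _ _ _) => *.
  by sign_module.
rewrite -E /lie_sum /=.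
move: (scap mu m _ x) (scap mu m _ x) (scap mu m g y) => *.
by sign_module.
Qed.

(** * Passage to homology *)

Lemma homology_map_class (U V W U' V' W' : lmodType k)
    (d1 : {linear U -> V}) (d0 : {linear V -> W})
    (d1' : {linear U' -> V'}) (d0' : {linear V' -> W'}) (f : V -> V')
    (x : Defs.cycle d0) :
  linear f ->
  (forall v, d0 v = 0 -> d0' (f v) = 0) ->
  (forall u, exists u', f (d1 u) = d1' u') ->
  exists2 y : Defs.cycle d0', val y = f (val x) &
    homology_map d1' d0' f (homology_class d1 x) = homology_class d1' y.
Proof.
move=> fl fZ fB.
have yP : f (val x) \in is_cycle d0'.
  by rewrite inE; apply/eqP/fZ; move: (valP x); rewrite inE => /eqP.
exists (Cycle yP) => //; apply: homology_mapE => // u v.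
by rewrite -scaleN1r (linear_funD fl) (linear_funZ fl) scaleN1r.
Qed.

Lemma lie_cycle p n m (f : O p) (x : M n) :
  cobdry mu f = 0 -> bdry mu x = 0 -> bdry mu (lie m f x) = 0.
Proof.
move=> fc x0; have [/eqP d|/eqP d] := boolP ((m + p)%N == n.+1); last first.
  by rewrite lie_deg // linear0.
case: m d => [|m] d; first exact: bdry_0.
rewrite lieE // linearZ /= bdry_lie_sum // x0.
by rewrite (linear_fun0 (@lie_sum_linearr _ _ _ _ _ _ _)) !scaler0.
Qed.

Lemma lie_boundary p n m (f : O p) (x : M n.+1) :
  cobdry mu f = 0 ->
  exists u : M m.+1, lie m f (bdry mu x : M n) = bdry mu u.
Proof.
move=> fc; have [/eqP d|/eqP d] := boolP ((m + p)%N == n.+1); last first.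
  by exists 0; rewrite lie_deg // linear0.
by exists (lie_sum m.+1 f x); rewrite lieE //= bdry_lie_sum //; lia.
Qed.

Lemma cap_cycle q n m e (g : O q) (x : M n) :
  multiplication mu e -> cobdry mu g = 0 -> bdry mu x = 0 ->
  bdry mu (cap mu m g x) = 0.
Proof.
move=> mue gc x0; have [/eqP d|/eqP d] := boolP ((m + q)%N == n); last first.
  by rewrite cap_deg // linear0.
case: m d => [|m] d; first exact: bdry_0.
rewrite capE linearZ /= (bdry_scap _ mue) // x0.
by rewrite (linear_fun0 (@scap_linearr _ _ _ _ _ _ _ _)) !scaler0.
Qed.

Lemma cap_boundary q n m e (g : O q) (x : M n.+1) :
  multiplication mu e -> cobdry mu g = 0 ->
  exists u : M m.+1, cap mu m g (bdry mu x : M n) = bdry mu u.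
Proof.
move=> mue gc; have [/eqP d|/eqP d] := boolP ((m + q)%N == n); last first.
  by exists 0; rewrite cap_deg // linear0.
exists (- scap mu m.+1 g x); rewrite linearN /= (bdry_scap _ mue) //=; last by
  lia.
by rewrite capE; sign_module.
Qed.

Lemma lie_homology_class p n m (f : O p) (x : Defs.cycle (@bdry k O mu M n)) :
  cobdry mu f = 0 ->
  exists2 y : Defs.cycle (@bdry k O mu M m), \val y = lie m f (\val x) &
    lie_homology mu f
      (homology_class (@bdry k O mu M n.+1) x : comp_homology mu M n)
    = homology_class (@bdry k O mu M m.+1) y :> comp_homology mu M m.
Proof.
move=> fc; apply: homology_map_class; first exact: lie_linear.
  by move=> v; apply: lie_cycle.
by move=> u; apply: lie_boundary.
Qed.

Lemma cap_homology_class q n m e (g : O q) (x : Defs.cycle (@bdry k O mu M n)) :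
  multiplication mu e -> cobdry mu g = 0 ->
  exists2 y : Defs.cycle (@bdry k O mu M m), \val y = cap mu m g (\val x) &
    cap_homology mu g
      (homology_class (@bdry k O mu M n.+1) x : comp_homology mu M n)
    = homology_class (@bdry k O mu M m.+1) y :> comp_homology mu M m.
Proof.
move=> mue gc; apply: homology_map_class; first exact: cap_linear.
  by move=> v; apply: cap_cycle mue gc.
by move=> u; apply: cap_boundary mue gc.
Qed.

(** For f = g = mu the graded commutator would only give 2 b b = 0. Instead A_mu A_mu = 0, its two
    double sums being opposite, and [wact_sum_circ_bar] with mu o mu = 0 kills the remaining
    products. *)
Lemma bdry_bdry n e (x : M n.+1) :
  multiplication mu e -> bdry mu (bdry mu x : M n) = 0.
Proof.
move=> [mu_assoc _ _]; case: n x => [|n] x; first exact: bdry_0.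
have dm : (n + (2 + 2))%N = n.+4 by lia.
have dl : n.+1 = (n.+3 - 2)%N by lia.
have mu0 : circ_bar 3 mu mu = 0.
  rewrite circ_bar2 /tcirc muln0 muln1 expr0 scale1r mu_assoc.
  by sign_module.
have := wact_sum_circ_bar mu mu x dm dl dl (erefl _).
rewrite mu0 (linear_fun0 (@wact_sum_linearl _ _ _ _ _ _ _)) => E.
rewrite !bdryE /= /lie_sum (linear_funD (@act_sum_linearr _ _ _ _ _ _ _)).
rewrite (linear_funD (@wact_sum_linearr _ _ _ _ _ _ _)).
rewrite (act_sum_act_sum mu mu x dm dl dl (erefl _)) mu0.
rewrite (linear_fun0 (@act_sum_linearl _ _ _ _ _ _ _)) [RHS]E.
by sign_module.
Qed.

Lemma cap_lie_homotopy p q n m (f : O p) (g : O q) (x : M n) :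
  cobdry mu f = 0 -> cobdry mu g = 0 -> bdry mu x = 0 ->
  (m + (p + q))%N = n.+1 ->
  exists u : M m.+1,
    cap mu m (bracket g f) x
    = cap mu m g (lie (n.+1 - p) f x)
      - (-1) ^+ (q * p.+1) *: lie m f (cap mu (n - q) g x) + bdry mu u.
Proof.
move=> fc gc x0 dm.
have dr : (q + p).-1 = (p + q).-1 by rewrite addnC.
have := scap_lie_sum fc gc x0 dm (erefl _) (erefl _) dr.
set u := right_ins _ _ _ _ _ => E.
exists ((-1) ^+ (p + q) *: ((-1) ^+ (p.+1 * q.+1) *: u)).
have -> : cap mu m (bracket g f) x = (-1) ^+ (p + q) *: scap mu m (bracket g
  f) x.
  (* For p = q = 0 the degree of the bracket is truncated and the sign does not match, but the
     bracket is 0. *)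
  rewrite capE; case: (posnP (q + p)) => [pq0|pq].
    have -> : bracket g f = 0.
      have [q0 p0] : q = 0%N /\ p = 0%N by lia.
      by subst p q; rewrite /bracket !circ_barE !big_geq // scaler0 subr0.
    by rewrite (linear_fun0 (@scap_linearl _ _ _ _ _ _ _ _)) !scaler0.
  by apply: signZ_odd; rewrite prednK // addnC.
have -> : lie m f (cap mu (n - q) g x)
    = (-1) ^+ (p + q) *: lie_sum m f (scap mu (n - q) g x).
  have [qn|nq] := leqP q n.
    rewrite lieE ?capE; last by lia.
    rewrite (linear_funZ (@lie_sum_linearr _ _ _ _ _ _ _)).
    by move: (lie_sum _ _ _) => ?; sign_module.
  (* If q > n, the degree equation forces q = n + 1 and p = m = 0; then [n - q] is truncated to 0
     and both sides vanish. *)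
  have [p0 m0] : p = 0%N /\ m = 0%N by lia.
  subst p m; rewrite lie_deg ?/lie_sum ?/act_sum ?/wact_sum; last by lia.
  by rewrite !big_geq // addr0 scaler0.
rewrite capE lieE; last by lia.
rewrite (linear_funZ (@scap_linearr _ _ _ _ _ _ _ _)).
rewrite !(linear_funZ (@bdry_linear k O mu M _)).
move/(canRL (subrK _)): E => ->; rewrite /bracket.
move: (lie_sum _ _ _) (scap _ _ _ _) (bdry _ _) => *.
by sign_module.
Qed.

End Homotopy.

(** * The commutator identity on homology *)

(* The identity is one of maps H_n(M) -> H_m(M), m = n - p - q + 1; for negative
   n - p - q + 1 the target is 0.  If n - q < 0, then iota_psi : H_n -> H_(n -
     q)
   is 0, here as the zero map into H_0. *)
Theorem theorem1p4 (k : comPzRingType) (O : operad k) (mu : O 2%N) (e : O 0%N)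
    (Hmu : multiplication mu e) (M : cyclic_module O)
    (p q : nat) (phi : O p) (psi : O q)
    (Hphi : cobdry mu phi = 0) (Hpsi : cobdry mu psi = 0)
    (n m : nat) (Hm : (m + (p + q))%N = n.+1) (c : comp_homology mu M n) :
  cap_homology mu psi
      (lie_homology mu phi c : comp_homology mu M (n.+1 - p))
    - (-1) ^+ (q * p.+1)
      *: lie_homology mu phi
           (cap_homology mu psi c : comp_homology mu M (n - q))
  = cap_homology mu (bracket psi phi) c :> comp_homology mu M m.
Proof.
elim/homology_ind: c => x.
have bx : bdry mu (\val x) = 0 by apply/eqP; have := valP x; rewrite inE.
have [u uE] := cap_lie_homotopy Hphi Hpsi bx Hm.
(* That the cap product with the bracket preserves cycles and boundaries is read off the homotopy
   formula, instead of showing that the bracket is a cocycle. *)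
have bracket_cycle (v : M n) :
    bdry mu v = 0 -> bdry mu (cap mu m (bracket psi phi) v) = 0.
  move=> bv; have [w ->] := cap_lie_homotopy Hphi Hpsi bv Hm.
  have lc := cap_cycle m Hmu Hpsi (lie_cycle (n.+1 - p) Hphi bv).
  have cl := lie_cycle m Hphi (cap_cycle (n - q) Hmu Hpsi bv).
  rewrite -scaleNr 2!(linear_funD (@bdry_linear k O mu M m)).
  rewrite (linear_funZ (@bdry_linear k O mu M m)) lc cl.
  have -> : bdry mu (bdry mu w : M m) = 0 := bdry_bdry w Hmu.
  by rewrite scaler0 !addr0.
have bracket_boundary (v : M n.+1) :
    exists w : M m.+1, cap mu m (bracket psi phi) (bdry mu v : M n) = bdry mu w.
  (* Boundaries are cycles, so the formula applies to b v. *)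
  have [w ->] := cap_lie_homotopy Hphi Hpsi (bdry_bdry v Hmu) Hm.
  have [w1 ->] := lie_boundary (n.+1 - p) v Hphi.
  have [w2 ->] := cap_boundary m w1 Hmu Hpsi.
  have [w3 ->] := cap_boundary (n - q) v Hmu Hpsi.
  have [w4 ->] := lie_boundary m w3 Hphi.
  exists (w2 + (- (-1) ^+ (q * p.+1)) *: w4 + w).
  rewrite -scaleNr 2!(linear_funD (@bdry_linear k O mu M m.+1)).
  by rewrite (linear_funZ (@bdry_linear k O mu M m.+1)).
have [y1 y1E ->] := lie_homology_class (n.+1 - p) x Hphi.
have [z1 z1E ->] := cap_homology_class m y1 Hmu Hpsi.
have [y2 y2E ->] := cap_homology_class (n - q) x Hmu Hpsi.
have [z2 z2E ->] := lie_homology_class m y2 Hphi.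
have [z3 z3E E3] : exists2 z : Defs.cycle (@bdry k O mu M m),
    \val z = cap mu m (bracket psi phi) (\val x) &
    cap_homology mu (bracket psi phi)
      (homology_class (@bdry k O mu M n.+1) x : comp_homology mu M n)
    = homology_class (@bdry k O mu M m.+1) z :> comp_homology mu M m.
  by apply: homology_map_class; first exact: cap_linear.
rewrite [RHS]E3 [_ *: _]homology_classZ [- _]homology_classN.
(* By the homotopy formula the representatives of the two sides differ by - b u. *)
rewrite [LHS]homology_classD; apply/eqP/homology_classP; exists (- u).
rewrite linearN /= z3E uE -y1E -z1E -y2E -z2E.
by move: (bdry mu u) => b; rewrite opprD addrA subrr add0r.
Qed.
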